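(* If $q\ge 16$ and $q$ is even, then $\operatorname{achr}(K_6\square K_q)\ge 2q+4$.
   Context: For a finite simple graph $G$, $\operatorname{achr}(G)$ (the achromatic number) is the maximum number of colours in a proper vertex colouring of $G$ that is complete, i.e. every pair of distinct colours appears on the two ends of some edge. $K_6\square K_q$ is the Cartesian product of the complete graphs $K_6$ and $K_q$ (vertex set $[1,6]\times[1,q]$, two vertices adjacent iff they agree in exactly one coordinate). *)

(* Defs.v *)
From mathcomp Require Import all_boot.

Set Implicit Arguments.
Unset Strict Implicit.
Unset Printing Implicit Defensive.

Record sgraph := SGraph {
  vertex : finType;
  adj : rel vertex;
  adj_sym : symmetric adj;
  adj_irrefl : irreflexive adj }.

Definition proper_colouring (G : sgraph) (k : nat)
    (f : {ffun vertex G -> 'I_k}) : bool :=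
  [forall x, forall y, adj x y ==> (f x != f y)].

Definition complete_colouring (G : sgraph) (k : nat)
    (f : {ffun vertex G -> 'I_k}) : bool :=
  [forall a, forall b, (a != b) ==>
    [exists x, exists y, [&& adj x y, f x == a & f y == b]]].

(* Every colour has to occur, so that k is the number of colours of f;
   for k = 1 completeness alone does not ensure this. *)
Definition all_colours_used (G : sgraph) (k : nat)
    (f : {ffun vertex G -> 'I_k}) : bool :=
  [forall a, exists x, f x == a].

Definition has_complete_colouring (G : sgraph) (k : nat) : bool :=
  [exists f : {ffun vertex G -> 'I_k},
    [&& proper_colouring f, complete_colouring f & all_colours_used f]].

(* A colouring has at most #|vertex G| colours, so the bound on k loses nothing
   (see leq_achr). *)
Definition achr (G : sgraph) : nat :=
  \max_(k < #|vertex G|.+1 | has_complete_colouring G k) k.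

Lemma leq_achr (G : sgraph) (k : nat) :
  has_complete_colouring G k -> k <= achr G.
Proof.
move=> Hk; have ltk : k < #|vertex G|.+1.
  case/existsP: Hk => f /and3P[_ _ /forallP fsurj].
  rewrite ltnS -[k]card_ord -(card_codom (f := fun a => xchoose (existsP (fsurj a)))).
    exact: max_card.
  move=> a b /(congr1 f).
  by rewrite (eqP (xchooseP (existsP (fsurj a))))
             (eqP (xchooseP (existsP (fsurj b)))).
exact: (leq_bigmax_cond (Ordinal ltk)).
Qed.

Fact Kn_sym (n : nat) : symmetric (fun x y : 'I_n => x != y).
Proof. by move=> x y; rewrite eq_sym. Qed.

Fact Kn_irrefl (n : nat) : irreflexive (fun x y : 'I_n => x != y).
Proof. by move=> x; rewrite eqxx. Qed.

Definition Kn (n : nat) : sgraph := SGraph (@Kn_sym n) (@Kn_irrefl n).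

Section CartesianProduct.
Variables G H : sgraph.

Definition cart_adj : rel (vertex G * vertex H) := fun u v =>
  ((u.1 == v.1) && adj u.2 v.2) || ((u.2 == v.2) && adj u.1 v.1).

Fact cart_adj_sym : symmetric cart_adj.
Proof.
by move=> u v; rewrite /cart_adj !(eq_sym v.1) !(eq_sym v.2) !(adj_sym v.1)
  !(adj_sym v.2).
Qed.

Fact cart_adj_irrefl : irreflexive cart_adj.
Proof. by move=> u; rewrite /cart_adj !adj_irrefl !andbF. Qed.

Definition cart_prod : sgraph := SGraph cart_adj_sym cart_adj_irrefl.

End CartesianProduct.

Notation "G □ H" := (cart_prod G H) (at level 40, left associativity).

Lemma Kn_cart_adjE (p q : nat) (u v : vertex (Kn p □ Kn q)) :
  adj u v = (u.1 == v.1) (+) (u.2 == v.2).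
Proof. by rewrite /= /cart_adj /=; case: (u.1 == _); case: (u.2 == _). Qed.

(* Main.v *)
(** Write q = 2n + 4, so that 2q + 4 = 12 + 4n.  The 12 "short" colours occur
    twice each and fill a 6 x 4 block: four of them live in each of the row
    pairs {0,1}, {2,3}, {4,5}, and they are placed so that short colours of
    different row pairs share a column.  The other 4n colours occur three times
    each, n of them in each of the row triples {0,2,4}, {0,3,5}, {1,2,5},
    {1,3,4}; these triples meet one another and meet all three row pairs, so
    that no further column condition is needed.  In the remaining 2n columns,
    a row consists of the two families of n colours whose triples contain it,
    each cyclically shifted by the row number; as n >= 6, the six shifts
    differ and no colour is repeated in a column. *)

Require Import Defs.
From mathcomp Require Import all_boot all_algebra zify.

(** Columns and colours may range over any finite types, so the construction can work with sums and
    products instead of index arithmetic. *)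
Lemma leq_achr_grid (p q : nat) (C D : finType) (f : 'I_p -> D -> C) :
    #|D| = q ->
    (forall r, injective (f r)) ->
    (forall c, injective (f^~ c)) ->
    (forall a, exists r c, f r c = a) ->
    (forall a b, exists r c r' c',
      [/\ f r c = a, f r' c' = b & (r == r') || (c == c')]) ->
  #|C| <= achr (Kn p □ Kn q).
Proof.
move=> Dq; case: _ / Dq => rowI colI fsurj fmeet; apply: leq_achr.
pose g := [ffun v : vertex (Kn p □ Kn #|D|) =>
             enum_rank (f v.1 (enum_val v.2))] : {ffun _ -> 'I_#|C|}.
have gE r c : g (r, enum_rank c) = enum_rank (f r c) by rewrite ffunE enum_rankK.
apply/existsP; exists g; apply/and3P; split.
- apply/forallP=> -[r c]; apply/forallP=> -[r' c'].
  rewrite Kn_cart_adjE /= !ffunE /= (inj_eq enum_rank_inj).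
  have [<-|Dr] := eqVneq r r'; have [<-|Dc] := eqVneq c c' => //=.
    by rewrite (inj_eq (rowI r)) (inj_eq enum_val_inj).
  by apply: contra Dr => /eqP/colI->.
- apply/forallP=> a; apply/forallP=> b; apply/implyP=> Dab.
  have [r [c [r' [c' [fa fb rc]]]]] := fmeet (enum_val a) (enum_val b).
  apply/existsP; exists (r, enum_rank c).
  apply/existsP; exists (r', enum_rank c').
  rewrite !gE fa fb !enum_valK !eqxx !andbT Kn_cart_adjE /=.
  rewrite (inj_eq enum_rank_inj).
  (* Agreement in both coordinates would force [a = b], so the disjunction is exclusive, as
     adjacency demands. *)
  case: eqP rc => [Er|_]; case: eqP => [Ec|_] // _.
  by case/eqP: Dab; apply: enum_val_inj; rewrite -fa -fb Er Ec.
apply/forallP=> a; have [r [c fa]] := fsurj (enum_val a).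
by apply/existsP; exists (r, enum_rank c); rewrite gE fa enum_valK.
Qed.

(* The entries of columns 0 - 3 are the short colours 0 - 11; an entry 12 + t of
   columns 4 and 5 stands for the family of n colours on the t-th row triple. *)
Definition grid_pattern : seq (seq nat) :=
  [:: [:: 0; 1; 2; 3; 12; 13];
      [:: 1; 0; 3; 2; 14; 15];
      [:: 4; 6; 5; 7; 12; 14];
      [:: 5; 7; 4; 6; 13; 15];
      [:: 8; 10; 11; 9; 12; 15];
      [:: 9; 11; 10; 8; 13; 14]].

Definition pattern (r k : nat) : nat := nth 0 (nth [::] grid_pattern r) k.

Lemma pattern_lt r k : r < 6 -> k < 4 -> pattern r k < 12.
Proof. by case: r => [|[|[|[|[|[|//]]]]]] _; case: k => [|[|[|[|//]]]]. Qed.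

Lemma pattern_ge r k : r < 6 -> k < 2 -> 12 <= pattern r (4 + k) < 16.
Proof. by case: r => [|[|[|[|[|[|//]]]]]] _; case: k => [|[|//]]. Qed.

Lemma pattern_rowI r k k' :
  r < 6 -> k < 6 -> k' < 6 -> pattern r k = pattern r k' -> k = k'.
Proof.
move=> r6 k6 k'6 /eqP; rewrite nth_uniq => [/eqP//|||];
by move: r6; case: r => [|[|[|[|[|[|//]]]]]].
Qed.

Lemma pattern_colI r r' k :
  r < 6 -> r' < 6 -> k < 4 -> pattern r k = pattern r' k -> r = r'.
Proof.
by case: k => [|[|[|[|//]]]]; case: r => [|[|[|[|[|[|//]]]]]] _;
  case: r' => [|[|[|[|[|[|//]]]]]].
Qed.

(** A finite check. A shared column counts only for [k < 4]: columns 4 and 5 each stand for a whole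
    block, where equal [k] gives no common column of the grid. *)
Lemma pattern_meet x y : x < 16 -> y < 16 ->
  exists r k r' k', [/\ r < 6, r' < 6, k < 6, k' < 6 &
    [/\ pattern r k = x, pattern r' k' = y &
        r = r' \/ k = k' /\ k < 4]].
Proof.
have chk : all (fun x => all (fun y =>
    has (fun r => has (fun r' => has (fun k => has (fun k' =>
      [&& pattern r k == x, pattern r' k' == y &
          (r == r') || ((k == k') && (k < 4))])
      (iota 0 6)) (iota 0 6)) (iota 0 6)) (iota 0 6)) (iota 0 16)) (iota 0 16).
  by vm_compute.
move=> x16 y16; move/allP: chk => /(_ x); rewrite mem_iota => /(_ x16).
move/allP=> /(_ y); rewrite mem_iota => /(_ y16).
case/hasP=> r; rewrite mem_iota => r6 /hasP[r']; rewrite mem_iota => r'6.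
case/hasP=> k; rewrite mem_iota => k6 /hasP[k']; rewrite mem_iota => k'6.
case/and3P=> /eqP Ex /eqP Ey rk; exists r, k, r', k'; split=> //; split=> //.
by case/orP: rk => [/eqP|/andP[/eqP]]; [left | right].
Qed.

Section GridColouring.

Variable m : nat.

Definition grid_colouring (r : 'I_6) (c : 'I_4 + 'I_2 * 'I_m.+1) :
    'I_12 + 'I_4 * 'I_m.+1 :=
  match c with
  | inl k => inl (inord (pattern r k))
  | inr (h, j) => inr (inord (pattern r (4 + h) - 12), (j + inord r)%R)
  end.

Definition colour_class (a : 'I_12 + 'I_4 * 'I_m.+1) : nat :=
  match a with inl x => x | inr (t, _) => 12 + t end.

Lemma colour_class_lt a : colour_class a < 16.
Proof. by case: a => [x|[t i]] /=; [have := ltn_ord x | have := ltn_ord t]; lia. Qed.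

Lemma grid_colouring_rowI r : injective (grid_colouring r).
Proof.
move=> [k|[h j]] [k'|[h' j']] //=.
  case=> /(congr1 val) /=; rewrite !inordK ?pattern_lt // => /pattern_rowI Ek.
  by congr inl; apply/val_inj/Ek => //; apply: ltn_trans (ltn_ord _) _.
case=> /(congr1 val) /= + /eqP; rewrite eqn_modDr !modn_small // => Ep /eqP Ej.
move: Ep; have /andP[lo hi] := pattern_ge r h (ltn_ord r) (ltn_ord h).
have /andP[lo' hi'] := pattern_ge r h' (ltn_ord r) (ltn_ord h').
rewrite !inordK; [|lia|lia] => Ep.
have Eh : 4 + h = 4 + h'.
  by apply: (pattern_rowI r) => //; [rewrite (ltn_add2l 4 _ 2) .. | lia].
by congr (inr (_, _)); apply: val_inj; first exact: addnI Eh.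
Qed.

Lemma grid_colouring_colI c : 5 <= m -> injective (grid_colouring^~ c).
Proof.
move=> m5 r r'; case: c => [k|[h j]] /=.
  case=> /(congr1 val) /=; rewrite !inordK ?pattern_lt // => /pattern_colI Er.
  exact/val_inj/Er.
(* The shifts alone separate the rows: both row numbers are below [6 <= m.+1], so [inord] preserves
   them. *)
case=> _ /eqP; rewrite eqn_modDl !modn_small // => /eqP.
have := ltn_ord r; have := ltn_ord r' => r6 r'6.
by rewrite !inordK; [move/val_inj | lia | lia].
Qed.

(** A cyclic shift permutes a family, so a row that contains the family contains each of its
    colours. The clause on [c] carries column coincidences from the pattern to the grid. *)
Lemma grid_colouring_class a (r : 'I_6) (k : nat) :
    k < 6 -> pattern r k = colour_class a ->
  exists2 c, grid_colouring r c = a &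
    forall k4 : k < 4, c = inl (Ordinal k4).
Proof.
move=> k6; have [k4|k4] : k < 4 \/ 4 <= k by lia.
  have := pattern_lt r k (ltn_ord r) k4; case: a => [x|[t i]] /= plt Ep; last lia.
  exists (inl (Ordinal k4)) => [|k4']; last by congr inl; apply: val_inj.
  by congr inl; apply: val_inj; rewrite /= Ep inordK.
have k2 : k - 4 < 2 by lia.
have := pattern_ge r (k - 4) (ltn_ord r) k2; rewrite subnKC //.
case: a => [x|[t i]] /= /andP[lo hi] Ep; first by have := ltn_ord x; lia.
exists (inr (Ordinal k2, (i - inord r)%R)) => [|k4']; last lia.
rewrite /= subnKC // Ep GRing.subrK; congr (inr (_, _)).
by apply: val_inj; rewrite /= addKn inordK.
Qed.

Lemma grid_colouring_meet a b : exists r c r' c',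
  [/\ grid_colouring r c = a, grid_colouring r' c' = b & (r == r') || (c == c')].
Proof.
have [r [k [r' [k' [r6 r'6 k6 k'6 [Ea Eb rk]]]]]] :=
  pattern_meet _ _ (colour_class_lt a) (colour_class_lt b).
have [c fc Ec] := @grid_colouring_class a (Ordinal r6) k k6 Ea.
have [c' fc' Ec'] := @grid_colouring_class b (Ordinal r'6) k' k'6 Eb.
exists (Ordinal r6), c, (Ordinal r'6), c'; split=> //.
case: rk => [Er|[Ek k4]]; first by rewrite -val_eqE /= Er eqxx.
by subst k'; rewrite (Ec k4) (Ec' k4) eqxx orbT.
Qed.

End GridColouring.

Theorem proposition7 (q : nat) (hq : 16 <= q) (hev : ~~ odd q) :
  2 * q + 4 <= achr (Kn 6 □ Kn q).
Proof.
(* Here [m.+1] is the family size n; the successor form makes ['I_m.+1] a cyclic group, and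
   [16 <= q] becomes [6 <= m.+1]. *)
have [m m5 Eq] : exists2 m, 5 <= m & q = 4 + 2 * m.+1.
  by exists (q./2 - 3); have := odd_double_half q; rewrite (negbTE hev); lia.
have -> : 2 * q + 4 = #|{: 'I_12 + 'I_4 * 'I_m.+1}|.
  by rewrite card_sum card_prod !card_ord; lia.
apply: (@leq_achr_grid _ _ _ _ (@grid_colouring m)).
- by rewrite card_sum card_prod !card_ord.
- exact: grid_colouring_rowI.
- by move=> c; apply: grid_colouring_colI.
- by move=> a; have [r [c [_ [_ [fa _ _]]]]] := grid_colouring_meet m a a; exists r, c.
exact: grid_colouring_meet.
Qed.
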